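(* For every integer $q\ge 7$, the optimum of the degree-five orbit linear program \[ \text{minimize }\sum_{\lambda\in\mathcal P_4}N_q(\lambda)w_\lambda \quad\text{subject to}\quad \sum_{s\ge1}m_s(\mu)\,w_{\operatorname{pred}_s(\mu)}\ge1\ (\mu\in\mathcal P_5),\qquad w_\lambda\ge0\ (\lambda\in\mathcal P_4) \] is \[ C_{q,5}^{\mathrm{orb}}=\frac{q(q^3+10q^2+45q+64)}{120}. \] It is attained by the weights \[ (w_{(4)},w_{(3,1)},w_{(2,2)},w_{(2,1,1)},w_{(1^4)})=\left(1,\frac{11}{30},\frac{19}{30},\frac4{15},\frac15\right). \] Consequently, \[ \alpha_q(5)\le\left\lfloor\frac{q(q^3+10q^2+45q+64)}{120}\right\rfloor\qquad(q\ge7). \]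
   Context: For integers $q\ge 2$, $d\ge 0$, let $\Delta_q(d)=\{a\in\mathbb Z_{\ge0}^q:\sum_{i=1}^q a_i=d\}$, and let $e_1,\dots,e_q$ be the standard unit vectors of $\mathbb Z^q$. The graph $G_q(d)$ has vertex set $\Delta_q(d)$; distinct $a,b\in\Delta_q(d)$ are adjacent exactly when $a-b=e_i-e_j$ for some $i\ne j$. Write $\alpha_q(d)=\alpha(G_q(d))$ for its independence number. $\mathcal P_n$ is the set of integer partitions of $n$. For $\lambda\in\mathcal P_n$, $\ell(\lambda)$ is its number of parts and $m_s(\lambda)$ the multiplicity of the part $s$. $N_q(\lambda)=\dfrac{q(q-1)\cdots(q-\ell(\lambda)+1)}{\prod_{s\ge1}m_s(\lambda)!}$ is the number of vectors in $\mathbb Z_{\ge0}^q$ whose multiset of positive coordinates is $\lambda$. For $\mu\in\mathcal P_d$ and a part value $s$ occurring in $\mu$, $\operatorname{pred}_s(\mu)\in\mathcal P_{d-1}$ is obtained by replacing one part $s$ by $s-1$ (deleting it if it becomes $0$); terms with $m_s(\mu)=0$ are omitted from the sum. $(1^4)$ means $(1,1,1,1)$. *)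

(* Defs.v *)
From HB Require Import structures.
From mathcomp Require Import all_boot all_order all_algebra.
From mathcomp Require Import reals.

Set Implicit Arguments.
Unset Strict Implicit.
Unset Printing Implicit Defensive.

Import Order.TTheory GRing.Theory Num.Theory.

Local Open Scope nat_scope.

Definition is_intpart (n : nat) (s : seq nat) : bool :=
  [&& sorted geq s, 0 \notin s & sumn s == n].

Record intpart (n : nat) := IntPart {
  parts :> seq nat;
  _ : is_intpart n parts
}.

HB.instance Definition _ n := [isSub for @parts n].
HB.instance Definition _ n := [Countable of intpart n by <:].

(* Finiteness: a partition of n has at most n parts, each at most n, so it is
   recovered from the zero-padded n-tuple of its parts. *)
Section IntPartFinite.
Variable n : nat.

Definition intpart_pad (l : intpart n) : {ffun 'I_n -> 'I_n.+1} :=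
  [ffun i : 'I_n => inord (nth 0 l i)].

Definition intpart_unpad (f : {ffun 'I_n -> 'I_n.+1}) : option (intpart n) :=
  insub [seq x <- [seq val (f i) | i <- enum 'I_n] | x != 0].

Lemma intpart_padK : pcancel intpart_pad intpart_unpad.
Proof.
case=> l lP; have /and3P[_ l0 /eqP ls] := lP.
have le_n x : x \in l -> x <= n.
  by move=> xl; rewrite -ls (perm_sumn (perm_to_rem xl)) /= leq_addr.
have size_n : size l <= n.
  rewrite -[leqRHS]ls; elim: (l) l0 => //= x s IH.
  rewrite inE negb_or eq_sym -lt0n => /andP[x0 /IH h].
  by rewrite -add1n leq_add.
rewrite /intpart_unpad.
suff -> : [seq x <- [seq val (intpart_pad (IntPart lP) i) | i <- enum 'I_n]
             | x != 0] = l by rewrite insubT.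
have -> : [seq val (intpart_pad (IntPart lP) i) | i <- enum 'I_n]
          = [seq nth 0 l i | i <- iota 0 n].
  rewrite -val_enum_ord -map_comp; apply: eq_map => i /=.
  rewrite ffunE inordK // ltnS /=.
  case: (ltnP i (size l)) => hi; last by rewrite nth_default.
  by apply/le_n/mem_nth.
rewrite -[in iota 0 n](subnKC size_n) iotaD map_cat filter_cat add0n.
rewrite -/(mkseq (nth 0 l) _) mkseq_nth.
rewrite [X in _ ++ X](_ : _ = [::]) ?cats0.
  by apply/all_filterP/allP => x xl; apply: contraNneq l0 => <-.
apply/eqP; rewrite -[_ == _]negbK -has_filter -all_predC.
apply/allP => x /mapP[i]; rewrite mem_iota => /andP[hi _] -> /=.
by rewrite nth_default.
Qed.

HB.instance Definition _ : isFinite (intpart n) := PCanIsFinite intpart_padK.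

End IntPartFinite.

Definition mult (n : nat) (l : intpart n) (s : nat) : nat := count_mem s l.

Fact row_part_subproof (n : nat) : is_intpart n (if n == 0 then [::] else [:: n]).
Proof. by case: n => [|n]; rewrite /is_intpart //= addn0 eqxx. Qed.

Definition row_part (n : nat) : intpart n := IntPart (row_part_subproof n).

Definition pred_seq (s : nat) (l : seq nat) : seq nat :=
  sort geq [seq x <- s.-1 :: rem s l | x != 0].

(* The default value row_part d is only returned when s is not a part of mu,
   see predpartE. *)
Definition predpart (d : nat) (s : nat) (mu : intpart d.+1) : intpart d :=
  insubd (row_part d) (pred_seq s mu).

Lemma predpartE (d s : nat) (mu : intpart d.+1) :
  s \in parts mu -> parts (predpart s mu) = pred_seq s mu.
Proof.
case: mu => l lP /= smu; have /and3P[_ l0 /eqP ls] := lP.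
rewrite /predpart -[LHS]/(val _) val_insubd ifT //; apply/and3P; split.
- by apply: sort_sorted => x y; exact: leq_total.
- by rewrite mem_sort mem_filter eqxx.
have s0 : 0 < s by rewrite lt0n; apply: contraNneq l0 => <-.
rewrite /pred_seq (perm_sumn (permEl (perm_sort _ _))).
have sumf t : sumn [seq x <- t | x != 0] = sumn t.
  by elim: t => //= x t <-; case: eqP => [->|].
rewrite sumf /= -eqSS -addSn prednK // -ls.
by rewrite (perm_sumn (perm_to_rem smu)) /=.
Qed.

Section OrbitLP.
Local Open Scope ring_scope.
Variables (R : realType) (q : nat).

Definition orbit_size (n : nat) (l : intpart n) : R :=
  (q ^_ (size l))%:R / (\prod_(s <- undup l) (mult l s)`!)%:R.

(* The orbit linear program of degree d.+1. *)
Definition orb_objective (d : nat) (w : intpart d -> R) : R :=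
  \sum_(l : intpart d) orbit_size l * w l.

Definition orb_feasible (d : nat) (w : intpart d -> R) : Prop :=
  (forall mu : intpart d.+1,
     1 <= \sum_(s <- undup mu) (mult mu s)%:R * w (predpart s mu)) /\
  (forall l : intpart d, 0 <= w l).

Definition orb_optimum (d : nat) (c : R) : Prop :=
  (exists2 w : intpart d -> R, orb_feasible w & orb_objective w = c) /\
  (forall w : intpart d -> R, orb_feasible w -> c <= orb_objective w).

Definition orb5_value : R :=
  q%:R * (q%:R ^+ 3 + 10 * q%:R ^+ 2 + 45 * q%:R + 64) / 120.

End OrbitLP.

(* The five listed sequences are all the partitions of 4; the last branch is
   never reached. *)
Definition orb5_weights (R : realType) (l : intpart 4) : R :=
  match parts l with
  | [:: 4] => 1
  | [:: 3; 1] => 11 / 30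
  | [:: 2; 2] => 19 / 30
  | [:: 2; 1; 1] => 4 / 15
  | [:: 1; 1; 1; 1] => 1 / 5
  | _ => 0
  end%R.

Definition independent (T : finType) (e : rel T) (S : {set T}) : bool :=
  [forall x in S, forall y in S, ~~ e x y].

Definition indep_number (T : finType) (e : rel T) : nat :=
  \max_(S : {set T} | independent e S) #|S|.

(* Coordinates of a vector of nonnegative integers of sum d are at most d, so
   bounding them by d loses nothing and makes the type finite. *)
Definition simplex (q d : nat) : finType :=
  {a : {ffun 'I_q -> 'I_d.+1} | \sum_(i < q) a i == d}.

Definition simplex_vec (q d : nat) (a : simplex q d) : 'rV[int]_q :=
  (\row_(i < q) (val a i : nat)%:Z)%R.

Definition simplex_adj (q d : nat) : rel (simplex q d) :=
  fun a b => (a != b) &&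
    [exists i : 'I_q, exists j : 'I_q, (i != j) &&
      (simplex_vec a - simplex_vec b == delta_mx 0 i - delta_mx 0 j)%R].

Definition alpha (q d : nat) : nat := indep_number (@simplex_adj q d).

(* Main.v *)
(* The value of the linear program is certified by a dual solution. The bound
   on alpha is a weighted clique cover: for v of sum d the vectors v + e_i form
   a clique, so an independent set S contains at most one of them; giving the
   clique of v the weight w of the type of v, the constraints say that every
   vertex is covered with total weight at least 1, hence #|S| is at most the
   total weight of the cliques, which is the objective. *)
Require Import Defs.
From mathcomp Require Import all_boot all_order all_algebra.
From mathcomp Require Import reals ring lra zify.

Set Implicit Arguments.
Unset Strict Implicit.
Unset Printing Implicit Defensive.

Import Order.TTheory GRing.Theory Num.Theory.

(** * Sums and permutations counted with multiplicity *)

Lemma sum_undup_count (R : pzSemiRingType) (T : eqType) (s : seq T)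
    (F : T -> R) :
  (\sum_(x <- undup s) (count_mem x s)%:R * F x = \sum_(x <- s) F x)%R.
Proof.
rewrite -[RHS]big_undup_iterop_count; apply: eq_bigr => x _.
by rewrite Monoid.iteropE /= mulr_natl -GRing.iter_addr_0.
Qed.

(** The multinomial coefficient in product form. Permutations are split by their first entry [x];
    removing [x] from [s] takes one factor [count_mem x s] out of the product of factorials, and
    these multiplicities add up to [size s]. *)
Lemma size_permutations_count (T : eqType) (s r : seq T) :
  uniq r -> {subset s <= r} ->
  size (permutations s) * \prod_(x <- r) (count_mem x s)`! = (size s)`!.
Proof.
move=> r_uniq; have [n] := ubnP (size s); elim: n s => // n IH s lt_n sr.
have [/size0nil->|s_gt0] := posnP (size s); first by rewrite big1.
rewrite (perm_size (permutationsE _)) // size_allpairs_dep sumnE big_map.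
have step x : x \in undup s ->
    size (permutations (rem x s)) * \prod_(z <- r) (count_mem z s)`! =
    count_mem x s * ((size s).-1)`!.
  rewrite mem_undup => xs.
  have count_s z : count_mem z s = (x == z) + count_mem z (rem x s).
    by rewrite (permP (perm_to_rem xs)).
  have sz : size (rem x s) = (size s).-1 by rewrite size_rem.
  rewrite -sz -IH; first last.
  - by move=> z /mem_rem; exact: sr.
  - by rewrite sz -ltnS prednK.
  rewrite mulnCA; congr (_ * _).
  rewrite (bigD1_seq x) ?sr //= [in RHS](bigD1_seq x) ?sr //= mulnA.
  rewrite !count_s eqxx add1n factS; congr (_ * _).
  by apply: eq_bigr => z; rewrite count_s eq_sym => /negPf->.
rewrite big_distrl /= (eq_big_seq _ step) -big_distrl /=.
rewrite -[in RHS](prednK s_gt0) factS prednK //; congr (_ * _).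
have := sum_undup_count s (fun _ => 1%N : nat); rewrite sum1_size /= => <-.
by apply: eq_bigr => x _; rewrite GRing.mulr1 natn.
Qed.

(** Bypasses [insubd]: on concrete partitions both hypotheses hold by computation. *)
Lemma predpart_eq (d s : nat) (mu : intpart d.+1) (l : intpart d) :
  s \in parts mu -> pred_seq s mu = parts l -> predpart s mu = l.
Proof.
by move=> smu eq_l; apply: val_inj; exact: etrans (predpartE smu) eq_l.
Qed.

(** * Types of vectors and the size of an orbit *)

Definition coords (q n : nat) (v : {ffun 'I_q -> 'I_n}) : seq nat :=
  [seq (v i : nat) | i <- enum 'I_q].

(** The default [row_part d] is returned only when the coordinates do not sum to [d]. The bound [n]
    is independent of [d], so that a vector and its lowering can share one function type. *)
Definition vec_type (d q n : nat) (v : {ffun 'I_q -> 'I_n}) : intpart d :=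
  insubd (row_part d) (sort geq [seq x <- coords v | x != 0]).

Lemma geq_total : total geq.
Proof. by move=> x y; exact: leq_total. Qed.

Lemma geq_trans : transitive geq.
Proof. by move=> y x z /= yx zy; exact: leq_trans zy yx. Qed.

Lemma geq_anti : antisymmetric geq.
Proof. by move=> x y; rewrite andbC => /anti_leq. Qed.

Lemma vec_typeE (d q n : nat) (v : {ffun 'I_q -> 'I_n}) :
  \sum_(i < q) v i = d ->
  parts (vec_type d v) = sort geq [seq x <- coords v | x != 0].
Proof.
move=> vd; rewrite /vec_type -[LHS]/(val _) val_insubd ifT //.
apply/and3P; split.
- exact: sort_sorted geq_total _.
- by rewrite mem_sort mem_filter eqxx.
rewrite (perm_sumn (permEl (perm_sort _ _))) sumnE big_filter big_map.
rewrite big_mkcond big_enum -vd; apply/eqP/eq_bigr => i _.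
by case: eqP => [->|].
Qed.

Lemma perm_coords_vec_type (d q n : nat) (v : {ffun 'I_q -> 'I_n}) :
  \sum_(i < q) v i = d ->
  let l := vec_type d v in
  size l <= q /\ perm_eq (coords v) (l ++ nseq (q - size l) 0).
Proof.
move=> vd /=; rewrite vec_typeE //; set s := sort _ _.
have s_perm : perm_eq s [seq x <- coords v | x != 0] by rewrite perm_sort.
have size_s : size s + count_mem 0 (coords v) = q.
  rewrite (perm_size s_perm) size_filter addnC count_predC.
  by rewrite size_map size_enum_ord.
split; first by rewrite -size_s leq_addr.
rewrite -[in X in nseq X]size_s addKn -(perm_filterC (predC1 0) (coords v)).
rewrite perm_cat //; first by rewrite perm_sym.
suff -> : [seq x <- coords v | predC (predC1 0) x] =
    nseq (count_mem 0 (coords v)) 0 by [].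
elim: (coords v) => //= x c ->; by case: eqP => [->|].
Qed.

(** Taking coordinates embeds the vectors of type [l] into the rearrangements of [l] padded with
    zeros to length [q], and [orbit_size] counts the latter. Equality can fail when [n] is too small
    to allow every part of [l]. *)
Lemma card_vec_type (R : realType) (q d n : nat) (l : intpart d) :
  (#|[set v : {ffun 'I_q -> 'I_n} |
      (\sum_(i < q) v i == d)%N && (vec_type d v == l)]|%:R
   <= orbit_size R q l)%R.
Proof.
(* A member of a nonempty class provides [size l <= q], hence the length of the padding. *)
set A := [set v | _]; have [->|[v]] := set_0Vmem A.
  by rewrite cards0 divr_ge0.
rewrite inE => /andP[/eqP vd /eqP vl].
have := perm_coords_vec_type vd; rewrite vl => -[l_q _].
set t := l ++ nseq (q - size l) 0.
have size_t : size t = q by rewrite size_cat size_nseq subnKC.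
have le_A : #|A| <= size (permutations t).
  rewrite cardE -(size_map (@coords q n)); apply: uniq_leq_size.
    rewrite map_inj_uniq ?enum_uniq // => a b ab; apply/ffunP => i.
    by apply/val_inj; move/eq_in_map: ab; apply; rewrite mem_enum.
  move=> c /mapP[a]; rewrite mem_enum inE => /andP[/eqP ad /eqP al] ->.
  by rewrite mem_permutations /t -al; have [] := perm_coords_vec_type ad.
have l0 : 0 \notin parts l by case: (l) => s sP; have /and3P[] := sP.
have t_fact : size (permutations t) *
    (\prod_(s <- undup l) (mult l s)`!) = q ^_ (size l).
  (* The new factor is the factorial of the multiplicity of 0 in [t], which completes the
     multinomial product. *)
  apply/eqP; rewrite -(eqn_pmul2r (fact_gt0 (q - size l))) ffact_fact //.
  rewrite -[in eqbRHS]size_t.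
  rewrite -(@size_permutations_count _ t (0 :: undup l)); first last.
  - move=> x; rewrite mem_cat inE mem_undup => /orP[->|]; first exact: orbT.
    by rewrite mem_nseq => /andP[_ ->].
  - by rewrite /= undup_uniq mem_undup l0.
  rewrite big_cons {1}/t count_cat count_nseq mul1n (count_memPn l0) add0n.
  rewrite mulnA mulnAC; apply/eqP; congr (_ * _ * _).
  apply: eq_big_seq => x; rewrite mem_undup => xl.
  rewrite /t count_cat count_nseq /=; case: eqP => [x0|_]; last by rewrite addn0.
  by rewrite x0 xl in l0.
rewrite /orbit_size ler_pdivlMr -?natrM ?ler_nat -?t_fact.
  by rewrite leq_mul2r le_A orbT.
by rewrite ltr0n prodn_gt0 // => s; exact: fact_gt0.
Qed.

(** * Lowering one coordinate *)

(** The vector [a - e_i] if [a i] is positive, and [a] itself otherwise. *)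
Definition down (q n : nat) (a : {ffun 'I_q -> 'I_n.+1}) (i : 'I_q) :
  {ffun 'I_q -> 'I_n.+1} := [ffun k => inord (a k - (k == i))].

Lemma downE (q n : nat) (a : {ffun 'I_q -> 'I_n.+1}) (i k : 'I_q) :
  down a i k = a k - (k == i) :> nat.
Proof. by rewrite ffunE inordK // (leq_ltn_trans (leq_subr _ _)). Qed.

Lemma sum_down (q n d : nat) (a : {ffun 'I_q -> 'I_n.+1}) (i : 'I_q) :
  \sum_(k < q) a k = d.+1 -> a i != 0 :> nat -> \sum_(k < q) down a i k = d.
Proof.
rewrite (bigD1 i) //= -lt0n => ad ai; rewrite (bigD1 i) //= downE eqxx subn1.
rewrite (eq_bigr (fun k => a k : nat)) => [|k ki].
  by apply: succn_inj; rewrite -ad -addSn prednK.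
by rewrite downE (negPf ki) subn0.
Qed.

(** Links the cliques containing [a] to the terms of the constraint at the type of [a]. Both sides
    are sorted, so it suffices to compare them as multisets. *)
Lemma vec_type_down (q n d : nat) (a : {ffun 'I_q -> 'I_n.+1}) (i : 'I_q) :
  \sum_(k < q) a k = d.+1 -> a i != 0 :> nat ->
  vec_type d (down a i) = predpart (a i) (vec_type d.+1 a).
Proof.
move=> ad ai; apply/esym/predpart_eq.
  rewrite vec_typeE // mem_sort mem_filter ai /=.
  by apply: map_f; rewrite mem_enum.
rewrite !vec_typeE ?(sum_down ad) //.
apply/perm_sortP; [exact: geq_total|exact: geq_trans|exact: geq_anti|].
(* The vectors [a] and [down a i] agree on the indices in [rest]. *)
set rest := rem i (enum 'I_q).
have enum_perm : perm_eq (enum 'I_q) (i :: rest).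
  by rewrite perm_to_rem // mem_enum.
have rest_i k : k \in rest -> (k == i) = false.
  by rewrite mem_rem_uniq ?enum_uniq // inE => /andP[/negPf].
have coords_a :
    perm_eq (coords a) ((a i : nat) :: [seq (a k : nat) | k <- rest]).
  exact: perm_map enum_perm.
have coords_down :
    perm_eq (coords (down a i)) ((a i).-1 :: [seq (a k : nat) | k <- rest]).
  rewrite (perm_trans (perm_map _ enum_perm)) //= downE eqxx subn1 perm_cons.
  suff -> : [seq (down a i k : nat) | k <- rest] = [seq (a k : nat) | k <- rest] by [].
  by apply/eq_in_map => k /rest_i ki; rewrite downE ki subn0.
rewrite (permPr (perm_filter _ coords_down)).
set s := sort _ _.
have s_perm :
    perm_eq s ((a i : nat) :: [seq x <- [seq (a k : nat) | k <- rest] | x != 0]).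
  by rewrite perm_sort (perm_trans (perm_filter _ coords_a)) //= ai.
have ai_s : (a i : nat) \in s by rewrite (perm_mem s_perm) inE eqxx.
have :
    perm_eq (rem (a i : nat) s) [seq x <- [seq (a k : nat) | k <- rest] | x != 0].
  by rewrite -(perm_cons (a i : nat)) -(permPl (perm_to_rem ai_s)).
move=> /(perm_filter (fun x => x != 0)); rewrite filter_id /=.
(* The case distinction is whether the lowered part survives or becomes 0 and is deleted. *)
by case: ifP => // _; rewrite perm_cons.
Qed.

Local Open Scope ring_scope.

(** Turns a constraint into a sum over the nonzero coordinates of [a], that is, over the cliques
    containing [a]. *)
Lemma sum_coords_vec_type (R : pzSemiRingType) (q n d : nat)
    (a : {ffun 'I_q -> 'I_n}) (F : nat -> R) :
  (\sum_(k < q) a k = d)%N ->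
  let mu := vec_type d a in
  \sum_(s <- undup mu) (mult mu s)%:R * F s =
  \sum_(i < q | a i != 0 :> nat) F (a i).
Proof.
move=> ad /=; rewrite sum_undup_count vec_typeE //.
rewrite (perm_big _ (permEl (perm_sort _ _))) /= big_filter big_map.
by rewrite big_enum_cond.
Qed.

(** * The weighted clique cover *)

(** If [a - e_i = b - e_j], then [i = j] gives [a = b], while [i != j] gives [a - b = e_i - e_j], an
    edge inside [S]. *)
Lemma independent_down_inj (q d : nat) (S : {set simplex q d.+1}) :
  independent (@simplex_adj q d.+1) S ->
  forall (a b : simplex q d.+1) (i j : 'I_q),
    a \in S -> b \in S -> val a i != 0 :> nat -> val b j != 0 :> nat ->
    down (val a) i = down (val b) j -> (a, i) = (b, j).
Proof.
move=> S_ind a b i j aS bS ai bj ab.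
have eq_ab k : (val a k - (k == i) = val b k - (k == j))%N by rewrite -!downE ab.
have [ij|ij] := eqVneq i j.
  subst j; congr (_, _); apply/val_inj/ffunP => k; apply/ord_inj.
  by have := eq_ab k; case: eqP => [->|_]; lia.
have /forall_inP/(_ _ aS)/forall_inP/(_ _ bS)/negP[] := S_ind.
apply/andP; split.
  apply: contraNneq ij => eab; subst b.
  by have := eq_ab i; rewrite eqxx; case: (i == j) => //; lia.
apply/existsP; exists i; apply/existsP; exists j; rewrite ij /=.
apply/eqP/rowP => k; rewrite !mxE !eqxx !andTb !natz.
case: (eqVneq k i) (eq_ab k) => [->|_]; first by rewrite (negPf ij); lia.
by case: (eqVneq k j) => [->|_]; lia.
Qed.

Lemma alpha_le_orb_objective (R : realType) (q d : nat) (w : intpart d -> R) :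
  orb_feasible w -> (alpha q d.+1)%:R <= orb_objective q w.
Proof.
case=> cover w_ge0; rewrite /alpha /indep_number.
pose P k : Prop := k%:R <= orb_objective q w.
(* Closure under [maxn] reduces the bound on the maximum to one independent set. *)
have P_max m n : P m -> P n -> P (maxn m n) by rewrite /maxn; case: ifP.
apply: (big_ind P) => // [|S S_ind]; rewrite /P.
  by apply: sumr_ge0 => l _; rewrite mulr_ge0 // divr_ge0.
pose T := {ffun 'I_q -> 'I_d.+2}.
pose D (v : T) := (\sum_(k < q) v k == d)%N.
pose I (p : simplex q d.+1 * 'I_q) := (p.1 \in S) && (val p.1 p.2 != 0 :> nat).
pose f (p : simplex q d.+1 * 'I_q) : T := down (val p.1) p.2.
(* Each [a] in [S] contributes at least 1 to this sum, by the constraint at its type. *)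
apply: (@le_trans _ _ (\sum_(p | I p) w (vec_type d (f p)))).
  rewrite -sum1_card natr_sum /I.
  rewrite -(pair_big_dep (mem S) (fun a i => val a i != 0 :> nat)
    (fun a i => w (vec_type d (down (val a) i)))) /=.
  apply: ler_sum => a _; have ad := eqP (valP a).
  apply: le_trans (cover (vec_type d.+1 (val a))) _.
  rewrite (sum_coords_vec_type (fun s => w (predpart s _)) ad).
  by apply: ler_sum => i ai; rewrite vec_type_down.
have fD p : I p -> D (f p).
  by case/andP=> _ ai; apply/eqP/(sum_down (eqP (valP p.1)) ai).
rewrite (partition_big f D fD) /=.
(* Pairs are grouped by their lowered vector; injectivity leaves at most one pair for each
   vector. *)
apply: (@le_trans _ _ (\sum_(v | D v) w (vec_type d v))).
  apply: ler_sum => v _.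
  rewrite (eq_bigr (fun=> w (vec_type d v))) => [|p /andP[_ /eqP->] //].
  rewrite sumr_const -mulr_natl ler_piMl // lern1; apply/card_le1_eqP.
  move=> [a i] [b j] /andP[/andP[aS ai] /eqP av] /andP[/andP[bS bj] /eqP bv].
  exact/esym/(independent_down_inj S_ind aS bS ai bj (etrans av (esym bv))).
(* Vectors are now grouped by type, and each class has at most [orbit_size] elements. *)
rewrite (partition_big (@vec_type d q d.+2) predT) //=.
apply: ler_sum => l _.
rewrite (eq_bigr (fun=> w l)) => [|v /andP[_ /eqP->] //].
rewrite sumr_const -mulr_natl ler_wpM2r //.
apply: le_trans (card_vec_type R q d.+2 l); rewrite ler_nat.
by apply: subset_leq_card; apply/subsetP => v; rewrite inE.
Qed.

(* Enumeration of integer partitions *)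
Local Close Scope ring_scope.

(* [k] is fuel: [n < k] suffices to reach every partition of [n] with parts at
   most [m]. *)
Fixpoint partition_seqs (k n m : nat) : seq (seq nat) :=
  if k is k'.+1 then
    (if n == 0 then [:: [::]] else [::]) ++
    [seq x :: l | x <- iota 1 (minn m n), l <- partition_seqs k' (n - x) x]
  else [::].

Lemma mem_partition_seqs (k n m : nat) (s : seq nat) :
  path geq m s -> 0 \notin s -> sumn s = n -> n < k ->
  s \in partition_seqs k n m.
Proof.
elim: k n m s => // k IH n m [|x s] /=; first by move=> _ _ <-.
case/andP=> xm xs; rewrite inE negb_or => /andP[x0 s0] sn nk.
rewrite mem_cat; apply/orP; right; apply/allpairsPdep; exists x, s; split=> //.
  by rewrite mem_iota; lia.
by apply: IH => //; lia.
Qed.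

(** For a concrete [n] the right-hand side evaluates to an explicit list, from which the case
    analyses for 4 and 5 are read off. *)
Lemma intpart_mem (n : nat) (l : intpart n) :
  parts l \in partition_seqs n.+1 n n.
Proof.
case: l => s sP; have /and3P[ss s0 /eqP sn] := sP; rewrite [parts _]/=.
apply: mem_partition_seqs => //.
by case: s ss {s0 sP} sn => //= x s -> <-; rewrite leq_addr.
Qed.

Definition part4 : intpart 4 := @IntPart 4 [:: 4] isT.
Definition part31 : intpart 4 := @IntPart 4 [:: 3; 1] isT.
Definition part22 : intpart 4 := @IntPart 4 [:: 2; 2] isT.
Definition part211 : intpart 4 := @IntPart 4 [:: 2; 1; 1] isT.
Definition part1111 : intpart 4 := @IntPart 4 [:: 1; 1; 1; 1] isT.

Lemma intpart4P (l : intpart 4) :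
  l \in [:: part4; part31; part22; part211; part1111].
Proof.
have := intpart_mem l; rewrite !inE -!val_eqE /=.
by do 4!(case/orP=> [->|]; rewrite ?orbT //); move=> ->; rewrite ?orbT.
Qed.

(** * The degree-five program in explicit form *)

Local Open Scope ring_scope.

Lemma big_intpart4 (R : nmodType) (F : intpart 4 -> R) :
  \sum_(l : intpart 4) F l =
  F part4 + F part31 + F part22 + F part211 + F part1111.
Proof.
rewrite -(@perm_big _ _ _ _ [:: part4; part31; part22; part211; part1111]).
  by rewrite !big_cons big_nil /= addr0 !addrA.
apply: uniq_perm; rewrite ?index_enum_uniq // => l.
by rewrite intpart4P mem_index_enum.
Qed.

(** Holds for [k > n] too, since [n ^_ k] is then already 0; thus the orbit sizes are polynomials in
    [q] for every [q]. *)
Lemma natr_ffactnSr (R : pzRingType) (n k : nat) :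
  (n ^_ k.+1)%:R = (n ^_ k)%:R * (n%:R - k%:R) :> R.
Proof.
rewrite ffactnSr natrM; case: (leqP k n) => [kn|nk]; first by rewrite natrB.
by rewrite ffact_small // !mul0r.
Qed.

Lemma orb_objective4E (R : realType) (q : nat) (w : intpart 4 -> R) :
  let Q : R := q%:R in
  orb_objective q w =
    Q * w part4 + Q * (Q - 1) * w part31 + Q * (Q - 1) / 2 * w part22 +
    Q * (Q - 1) * (Q - 2) / 2 * w part211 +
    Q * (Q - 1) * (Q - 2) * (Q - 3) / 24 * w part1111.
Proof.
rewrite /orb_objective big_intpart4 /orbit_size /mult /= !big_cons !big_nil /=.
rewrite !natr_ffactnSr ffactn0 !(add0n, addn0) !add1n !factS fact0.
by field.
Qed.

Definition orb_cover (R : realType) (d : nat) (w : intpart d -> R)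
    (mu : intpart d.+1) : R :=
  \sum_(s <- undup mu) (mult mu s)%:R * w (predpart s mu).

Definition part5 : intpart 5 := @IntPart 5 [:: 5] isT.
Definition part41 : intpart 5 := @IntPart 5 [:: 4; 1] isT.
Definition part32 : intpart 5 := @IntPart 5 [:: 3; 2] isT.
Definition part311 : intpart 5 := @IntPart 5 [:: 3; 1; 1] isT.
Definition part221 : intpart 5 := @IntPart 5 [:: 2; 2; 1] isT.
Definition part2111 : intpart 5 := @IntPart 5 [:: 2; 1; 1; 1] isT.
Definition part11111 : intpart 5 := @IntPart 5 [:: 1; 1; 1; 1; 1] isT.

Lemma intpart5P (l : intpart 5) :
  l \in [:: part5; part41; part32; part311; part221; part2111; part11111].
Proof.
have := intpart_mem l; rewrite !inE -!val_eqE /=.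
by do 6!(case/orP=> [->|]; rewrite ?orbT //); move=> ->; rewrite ?orbT.
Qed.

Lemma orb_cover5 (R : realType) (w : intpart 4 -> R) :
  orb_cover w part5 = w part4.
Proof.
rewrite /orb_cover /mult !big_cons big_nil (predpart_eq (l := part4)) //=.
by rewrite addn0 mul1r addr0.
Qed.

Lemma orb_cover41 (R : realType) (w : intpart 4 -> R) :
  orb_cover w part41 = w part31 + w part4.
Proof.
rewrite /orb_cover /mult !big_cons big_nil (predpart_eq (l := part31)) //.
by rewrite (predpart_eq (l := part4)) //= !(addn0, add0n) !mul1r addr0.
Qed.

Lemma orb_cover32 (R : realType) (w : intpart 4 -> R) :
  orb_cover w part32 = w part22 + w part31.
Proof.
rewrite /orb_cover /mult !big_cons big_nil (predpart_eq (l := part22)) //.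
by rewrite (predpart_eq (l := part31)) //= !(addn0, add0n) !mul1r addr0.
Qed.

Lemma orb_cover311 (R : realType) (w : intpart 4 -> R) :
  orb_cover w part311 = w part211 + 2 * w part31.
Proof.
rewrite /orb_cover /mult !big_cons big_nil (predpart_eq (l := part211)) //.
by rewrite (predpart_eq (l := part31)) //= !(addn0, add0n) mul1r addr0.
Qed.

Lemma orb_cover221 (R : realType) (w : intpart 4 -> R) :
  orb_cover w part221 = 2 * w part211 + w part22.
Proof.
rewrite /orb_cover /mult !big_cons big_nil (predpart_eq (l := part211)) //.
by rewrite (predpart_eq (l := part22)) //= !(addn0, add0n) mul1r addr0.
Qed.

Lemma orb_cover2111 (R : realType) (w : intpart 4 -> R) :
  orb_cover w part2111 = w part1111 + 3 * w part211.
Proof.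
rewrite /orb_cover /mult !big_cons big_nil (predpart_eq (l := part1111)) //.
by rewrite (predpart_eq (l := part211)) //= !(addn0, add0n) mul1r addr0.
Qed.

Lemma orb_cover11111 (R : realType) (w : intpart 4 -> R) :
  orb_cover w part11111 = 5 * w part1111.
Proof.
rewrite /orb_cover /mult !big_cons big_nil (predpart_eq (l := part1111)) //=.
by rewrite addr0.
Qed.

(** * Dual and primal certificates *)

(* The multipliers in the proof are the dual solution vanishing on (4,1) and
   (2,2,1), which complementary slackness forces; the one of (1^5) is a multiple
   of q^2 - 9q + 16, negative at q = 6, which is why q >= 7 is assumed. *)
Lemma orb_objective4_ge (R : realType) (q : nat) (w : intpart 4 -> R) :
  (7 <= q)%N -> orb_feasible w -> orb5_value R q <= orb_objective q w.
Proof.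
move=> q7 [C _].
have q7R : 7 <= q%:R :> R by rewrite ler_nat.
have Cge mu : 1 <= orb_cover w mu := C mu.
have:= Cge part5; rewrite orb_cover5 => h5.
have:= Cge part32; rewrite orb_cover32 => h32.
have:= Cge part311; rewrite orb_cover311 => h311.
have:= Cge part2111; rewrite orb_cover2111 => h2111.
have:= Cge part11111; rewrite orb_cover11111 => h11111.
rewrite orb_objective4E /orb5_value -subr_ge0; set Q : R := q%:R.
have y_ge0 : [/\ 0 <= Q, 0 <= Q * (Q - 1), 0 <= Q * (Q - 1) * (2 * Q - 5)
   & 0 <= Q * (Q - 1) * (Q ^+ 2 - 9 * Q + 16)].
  by split; rewrite ?mulr_ge0 //; rewrite -/Q in q7R; nra.
case: y_ge0 => y5 y32 y2111 y11111.
rewrite [X in 0 <= X](_ : _ =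
    Q * (w part4 - 1) + Q * (Q - 1) / 2 * (w part22 + w part31 - 1)
  + Q * (Q - 1) / 4 * (w part211 + 2 * w part31 - 1)
  + Q * (Q - 1) * (2 * Q - 5) / 12 * (w part1111 + 3 * w part211 - 1)
  + Q * (Q - 1) * (Q ^+ 2 - 9 * Q + 16) / 120 * (5 * w part1111 - 1)).
  by rewrite !addr_ge0 // mulr_ge0 ?subr_ge0 ?divr_ge0.
by field.
Qed.

(** Equality holds at (5), (3,2), (3,1,1), (2,1,1,1) and (1^5), and these five equations determine
    the weights. The slack is 11/30 at (4,1) and 1/6 at (2,2,1). *)
Lemma orb5_weights_feasible (R : realType) : orb_feasible (@orb5_weights R).
Proof.
split=> [mu|l]; last first.
  have := intpart4P l; rewrite !inE /orb5_weights.
  by do 4!(case/orP=> [/eqP->/=|]; first lra); move=> /eqP->/=; lra.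
rewrite -/(orb_cover _ _); have := intpart5P mu; rewrite !inE.
case/orP=> [/eqP->|]; first by rewrite orb_cover5.
case/orP=> [/eqP->|]; first by rewrite orb_cover41 /orb5_weights /=; lra.
case/orP=> [/eqP->|]; first by rewrite orb_cover32 /orb5_weights /=; lra.
case/orP=> [/eqP->|]; first by rewrite orb_cover311 /orb5_weights /=; lra.
case/orP=> [/eqP->|]; first by rewrite orb_cover221 /orb5_weights /=; lra.
case/orP=> [/eqP->|/eqP->]; first by rewrite orb_cover2111 /orb5_weights /=; lra.
by rewrite orb_cover11111 /orb5_weights /=; lra.
Qed.

Lemma orb5_weights_objective (R : realType) (q : nat) :
  orb_objective q (@orb5_weights R) = orb5_value R q.
Proof. by rewrite orb_objective4E /orb5_weights /orb5_value /=; field. Qed.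

Theorem proposition9p3 (R : realType) (q : nat) (hq : (7 <= q)%N) :
  [/\ orb_optimum q 4 (orb5_value R q),
      orb_feasible (orb5_weights R) /\
      orb_objective q (orb5_weights R) = orb5_value R q
    & ((alpha q 5)%:Z <= Num.floor (orb5_value R q))%R].
Proof.
have feas := orb5_weights_feasible R; have obj := orb5_weights_objective R q.
split=> //.
  split; first by exists (@orb5_weights R).
  by move=> w; exact: orb_objective4_ge.
(* As [alpha] is an integer, a bound by the real value gives the bound by its floor. *)
by rewrite Num.Theory.floor_ge_int -obj; exact: alpha_le_orb_objective.
Qed.
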